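(* For each of the Kähler, almost Kähler and Spin$^c$ quantizations and each $x\in M$, the coherent state $\Phi^{(k)}_x$ maximizes $|s(x)|^2$ over all $s\in\overline{L^k_x}\otimes\mathcal H_k$ with $\|s\|^2=\varepsilon^{(k)}(x)$.
   Context: Setting. $(M,\omega)$ is a compact symplectic manifold of dimension $2n$ with $[\omega/2\pi]$ integral; $\ell\to M$ is a Hermitian line bundle with compatible connection $\nabla$ of curvature $-i\omega$; $\ell^{\otimes k}$ carries the induced Hermitian structure $h$ (conjugate linear in the first argument) and connection. $\epsilon_\omega=(2\pi)^{-n}\omega^{\wedge n}/n!$. $J$ is an $\omega$-compatible almost complex structure, $g=\omega(\cdot,J\cdot)$, $TM_{\mathbb C}=TM^{(1,0)}\oplus TM^{(0,1)}$ is the $\pm i$-eigenspace decomposition, and $d_k=\int_M \mathrm{ch}(\ell^{\otimes k})\,\mathrm{Td}(TM^{(1,0)})$. For sections $s_1,s_2$, $\langle s_1|s_2\rangle=\int_M h(s_1,s_2)\,\epsilon_\omega$. Quantizations. The bundle $L^k$ and the quantum Hilbert space $\mathcal H_k\subset L^2(M,L^k)$, with $\dim\mathcal H_k=d_k<\infty$ and consisting of smooth sections, are one of the following. (i) Kähler ($J$ integrable): $L^k=\ell^{\otimes k}$ and $\mathcal H_k$ is the space of sections $s$ with $\nabla_Xs=0$ for all $X\in\Gamma(TM^{(0,1)})$ (holomorphic sections). (ii) Almost Kähler: $L^k=\ell^{\otimes k}$ and $\mathcal H_k$ is the span of orthonormal eigensections for the first $d_k$ eigenvalues (in nondecreasing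 order, with multiplicity) of $\Delta_k=\Delta-nk$, where $\Delta$ is the Laplacian on sections of $\ell^{\otimes k}$ for $g$ and $\nabla$. (iii) Spin$^c$: $L^k=\Lambda^{0,*}(T^*M)\otimes\ell^{\otimes k}$ with the Hermitian structure $h$ induced by $g$ and $h$, and $\mathcal H_k=\ker D_+\ominus\ker D_-$, where $D_\pm$ are the even/odd parts of the Spin$^c$ Dirac operator on $L^k$ determined by $(J,g,\nabla)$. Throughout $k$ is large enough that the relevant vanishing/existence theorem holds (in (i), $\dim\mathcal H_k=d_k$; in (ii), with constants $a>0$ and $C$ independent of $k$, the first $d_k$ eigenvalues of $\Delta_k$ lie in $(-a,a)$ and the others lie to the right of $nk+C$; in (iii), $\ker D_-=0$, so $\mathcal H_k=\ker D_+$). $\{\theta^{(k)}_j\}_{j=1}^{d_k}$ is any orthonormal basis of $\mathcal H_k$. Definitions. $\varepsilon^{(k)}(x)=\sum_j|\theta^{(k)}_j(x)|^2$ and $\Phi^{(k)}_x=\sum_j\overline{\theta^{(k)}_j(x)}\otimes\theta^{(k)}_j\in\overline{L^k_x}\otimes\mathcal H_k$. An element $s\in\overline{L^k_x}\otimes\mathcal H_k$ is written $s=\sum_j\overline{u_j}\otimes\theta^{(k)}_j$ with $u_j\in L^k_x$; its norm is that of the tensor product, $\|s\|^2=\sum_j|u_j|^2$ (so $\|\Phi^{(k)}_x\|^2=\varepsilon^{(k)}(x)$). With the convention identifying $\overline u\otimes v\in\overline{L^k_x}\otimes L^k_x$ with $h(u,v)\in\mathbb C$, the value $s(x)$ is the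 complex number $\sum_j h(u_j,\theta^{(k)}_j(x))$. *)

(* Defs.v *)
From HB Require Import structures.
From mathcomp Require Import all_boot all_order all_algebra all_fingroup.
From mathcomp Require Import complex.
From mathcomp Require Import all_classical all_reals all_analysis.

Set Implicit Arguments.
Unset Strict Implicit.
Unset Printing Implicit Defensive.

Import Order.TTheory GRing.Theory Num.Theory.
Import numFieldNormedType.Exports.

Local Open Scope classical_set_scope.
Local Open Scope ring_scope.
Local Open Scope complex_scope.

Section Euclidean.
Context {R : realType} {m : nat}.

(* [f] is C^oo at the points of the (open) set [U]: all its iterated
   directional derivatives are Frechet differentiable there. *)
Definition smooth_on {V : normedModType R} (U : set 'rV[R]_m)
    (f : 'rV[R]_m -> V) : Prop :=
  forall (vs : seq 'rV[R]_m) (y : 'rV[R]_m), U y ->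
    differentiable (foldr (fun v (g : 'rV[R]_m -> V) => 'D_v g) f vs) y.

End Euclidean.

(* Iterated one-dimensional Lebesgue integrals; only used on continuous
   functions with compact support. *)
Fixpoint euclidean_integral {R : realType} (m : nat) : ('rV[R]_m -> R) -> R :=
  match m return ('rV[R]_m -> R) -> R with
  | 0 => fun f => f 0
  | p.+1 => fun f =>
      \int[lebesgue_measure]_(t in [set: R])
        euclidean_integral
          (fun v : 'rV[R]_p => f (row_mx (t%:M : 'M[R]_1) v : 'rV[R]_(1 + p)))
  end.

(* A closed (compact, boundaryless) smooth manifold of dimension [m], given by
   an atlas.  [param i] is the inverse of the chart [coord i], and [at_ x] is
   some chart around [x]; it is used to evaluate expressions which do not
   depend on the chart. Second countability follows from compactness. *)
Record manifold (R : realType) (m : nat) := Manifold {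
  carrier :> ptopologicalType;
  index : Type;
  dom : index -> set carrier;
  coord : index -> carrier -> 'rV[R]_m;
  param : index -> 'rV[R]_m -> carrier;
  at_ : carrier -> index;
  mf_hausdorff : hausdorff_space carrier;
  mf_compact : compact [set: carrier];
  dom_open : forall i, open (dom i);
  dom_at : forall x, dom (at_ x) x;
  coord_open : forall i, open (coord i @` dom i);
  coordK : forall i x, dom i x -> param i (coord i x) = x;
  coord_cont : forall i, {within dom i, continuous (coord i)};
  param_cont : forall i, {within coord i @` dom i, continuous (param i)};
  transition_smooth : forall i j,
    smooth_on (coord i @` (dom i `&` dom j)) (coord j \o param i)
}.

Arguments dom {R m} X i : rename.
Arguments coord {R m} X i x : rename.
Arguments param {R m} X i y : rename.
Arguments at_ {R m} X x : rename.

(* Tangent vectors at [x] are row vectors of components in a chart around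
   [x], and endomorphisms act on them by multiplication on the right. *)
Section ManifoldCalculus.
Context {R : realType} {m : nat} (X : manifold R m).
Notation C := R[i].

Definition smooth_in {V : normedModType R} (i : index X) (U : set X)
    (f : X -> V) : Prop :=
  smooth_on (coord X i @` (dom X i `&` U)) (f \o param X i).

Definition csmooth_in (i : index X) (U : set X) (f : X -> C) : Prop :=
  smooth_in i U (fun x => complex.Re (f x) : R) /\
  smooth_in i U (fun x => complex.Im (f x) : R).

Definition pd {V : normedModType R} (i : index X) (a : 'I_m) (f : X -> V)
    (x : X) : V :=
  'D_(delta_mx 0 a : 'rV[R]_m) (f \o param X i) (coord X i x).

Definition cpd (i : index X) (a : 'I_m) (f : X -> C) (x : X) : C :=
  pd i a (fun y => complex.Re (f y) : R) x
    +i* pd i a (fun y => complex.Im (f y) : R) x.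

(* If [v] are the components of a tangent vector at [x] in the chart [i], its
   components in the chart [j] are [v *m jac i j x]. *)
Definition jac (i j : index X) (x : X) : 'M[R]_m :=
  jacobian (coord X j \o param X i) (coord X i x).

End ManifoldCalculus.

Section Forms.
Context {R : realType} {m : nat}.
Notation C := R[i].

(* An element of the complexified exterior algebra of the dual of R^m, possibly
   of mixed degree: its value on a list of length q is the value of its
   component of degree q. *)
Definition form : Type := seq 'rV[R]_m -> C.

Definition alternating (f : form) : Prop :=
  (forall (a : R) (v w : 'rV[R]_m) (us vs : seq 'rV[R]_m),
     f (us ++ (a *: v + w) :: vs) = a%:C * f (us ++ v :: vs) + f (us ++ w :: vs))
  /\
  (forall (v : 'rV[R]_m) (us vs : seq 'rV[R]_m), f (us ++ v :: v :: vs) = 0).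

Fixpoint shuffle_inversions (b : seq bool) : nat :=
  match b with
  | [::] => 0
  | c :: b' => ((if c then 0 else count id b') + shuffle_inversions b')%N
  end.

(* Normalized so that (f /\ g)(v, w) = f(v) g(w) - f(w) g(v) in degree 1. *)
Definition wedge (f g : form) : form := fun vs =>
  \sum_(b : (size vs).-tuple bool)
    (-1) ^+ shuffle_inversions b * f (mask b vs) * g (mask (map negb b) vs).

Definition form1 : form := fun vs => (size vs == 0%N)%:R.

Definition wpow (f : form) (q : nat) : form := iter q (wedge f) form1.

Definition bilin (W : 'M[R]_m) (v w : 'rV[R]_m) : R := (v *m W *m w^T) 0 0.

Definition two_form (W : 'M[R]_m) : form := fun vs =>
  if vs is [:: v; w] then (bilin W v w)%:C else 0.

Definition basis_vec (a : 'I_m) : 'rV[R]_m := delta_mx 0 a.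

Definition frame : seq 'rV[R]_m := [seq basis_vec a | a <- enum 'I_m].

(* Matrices of forms of even degree. *)
Definition fmatrix : Type := 'I_m -> 'I_m -> form.

Definition fm_const (A : 'M[C]_m) : fmatrix := fun a b vs => A a b * form1 vs.

Definition fm_add (A B : fmatrix) : fmatrix := fun a b vs => A a b vs + B a b vs.

Definition fm_mul (A B : fmatrix) : fmatrix := fun a b vs =>
  \sum_c wedge (A a c) (B c b) vs.

Definition fm_det (A : fmatrix) : form := fun vs =>
  \sum_(s : 'S_m)
    (-1) ^+ s * foldr wedge form1 [seq A a (s a) | a <- enum 'I_m] vs.

End Forms.

Arguments form R m : clear implicits.
Arguments fmatrix R m : clear implicits.
Arguments form1 {R m}.
Arguments frame R m : clear implicits.

Record symplectic_form {R : realType} {n : nat} (X : manifold R n.*2) :=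
  SymplecticForm {
  om : index X -> X -> 'M[R]_(n.*2);
  om_smooth : forall i, smooth_in i setT (om i);
  om_glue : forall i j x, dom X i x -> dom X j x ->
    om i x = jac i j x *m om j x *m (jac i j x)^T;
  om_alt : forall i x, dom X i x -> (om i x)^T = - om i x;
  om_nondeg : forall i x, dom X i x -> om i x \in unitmx;
  om_closed : forall i x a b c, dom X i x ->
    pd i a (fun y => om i y b c) x + pd i b (fun y => om i y c a) x
      + pd i c (fun y => om i y a b) x = 0
}.

Arguments om {R n X} s i x : rename.

(* A Hermitian line bundle, trivialized over each chart by a unitary frame: a
   section is a family of functions s_i with s_i = gl i j * s_j.  A
   connection compatible with the Hermitian structure is
   nabla s_i = d s_i - sqrt(-1) conn_i s_i with conn_i real, and its curvature
   is - sqrt(-1) d conn_i. *)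
Record prequantum_bundle {R : realType} {n : nat} {X : manifold R n.*2}
    (omega : symplectic_form X) := PrequantumBundle {
  gl : index X -> index X -> X -> R[i];
  gl_smooth : forall i j, csmooth_in i (dom X j) (gl i j);
  gl_unitary : forall i j x, dom X i x -> dom X j x -> `|gl i j x| = 1;
  gl_cocycle : forall i j l x, dom X i x -> dom X j x -> dom X l x ->
    gl i j x * gl j l x = gl i l x;
  conn : index X -> X -> 'rV[R]_(n.*2);
  conn_smooth : forall i, smooth_in i setT (conn i);
  conn_glue : forall i j x a, dom X i x -> dom X j x ->
    cpd i a (gl i j) x
      = 'i * ((conn i x - conn j x *m (jac i j x)^T) 0 a)%:C * gl i j x;
  conn_curvature : forall i x a b, dom X i x ->
    pd i a (fun y => conn i y 0 b) x - pd i b (fun y => conn i y 0 a) x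
      = om omega i x a b
}.

Arguments gl {R n X omega} p i j x : rename.
Arguments conn {R n X omega} p i x : rename.

Record compatible_acs {R : realType} {n : nat} {X : manifold R n.*2}
    (omega : symplectic_form X) := CompatibleACS {
  acs : index X -> X -> 'M[R]_(n.*2);
  acs_smooth : forall i, smooth_in i setT (acs i);
  acs_glue : forall i j x, dom X i x -> dom X j x ->
    acs i x *m jac i j x = jac i j x *m acs j x;
  acs_square : forall i x, dom X i x -> acs i x *m acs i x = - 1%:M;
  acs_invariant : forall i x v w, dom X i x ->
    bilin (om omega i x) (v *m acs i x) (w *m acs i x)
      = bilin (om omega i x) v w;
  acs_tame : forall i x v, dom X i x -> v != 0 ->
    0 < bilin (om omega i x) v (v *m acs i x)
}.

Arguments acs {R n X omega} c i x : rename.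

Section Geometry.
Context {R : realType} {n : nat} {X : manifold R n.*2}.
Context {omega : symplectic_form X}.
Notation C := R[i].
Notation m := (n.*2).
Notation borel := (g_sigma_algebraType (@open X)).

(* The coefficient of omega^n/n! in the chart [i]. *)
Definition volume_coef (i : index X) (x : X) : C :=
  wpow (two_form (om omega i x)) n (frame R m) / (n`!)%:R.

(* [mu] is integration against epsilon_omega = (2 pi)^-n omega^n/n!, M being
   oriented by omega^n.  By partitions of unity this determines [mu]. *)
Definition is_liouville (mu : {measure set borel -> \bar R}) : Prop :=
  forall (i : index X) (f : X -> R),
    continuous f -> closure [set x | f x != 0] `<=` dom X i ->
    (\int[mu]_x (f x)%:E)%E =
    ((2 * pi) ^- n *
      euclidean_integral
        ((fun y => f (param X i y) * `|complex.Re (volume_coef i (param X i y))|)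
           \_ (coord X i @` dom X i)))%:E.

Definition cintegral (mu : {measure set borel -> \bar R}) (f : X -> C) : C :=
  (\int[mu]_x (complex.Re (f x) : R))%R +i* (\int[mu]_x (complex.Im (f x) : R))%R.

(* The integral over M of the component of top degree of the differential form
   with value [tau i x] in the chart [i], as the integral of its
   quotient by epsilon_omega. *)
Definition integral_form (mu : {measure set borel -> \bar R})
    (tau : index X -> X -> form R m) : C :=
  cintegral mu (fun x =>
    tau (at_ X x) x (frame R m)
      / ((((2 * pi) ^- n : R)%:C) * volume_coef (at_ X x) x)).

Variable J : compatible_acs omega.

Definition metric (i : index X) (x : X) : 'M[R]_m :=
  om omega i x *m (acs J i x)^T.

Definition cometric (i : index X) (x : X) : 'M[R]_m := invmx (metric i x).

(* For constant [v], the covariant derivative of [v] along the [a]-th coordinate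
   field is [v *m christoffel i x a] for the Levi-Civita connection, and
   [v *m jchristoffel i x a] for the connection
   (nabla - J nabla J) / 2, i.e. P nabla P + P^bar nabla P^bar, where P and
   P^bar project on the types (1,0) and (0,1). *)
Definition christoffel (i : index X) (x : X) (a : 'I_m) : 'M[R]_m :=
  \matrix_(b, c) (2^-1 * \sum_d cometric i x d c *
    (pd i a (fun y => metric i y b d) x + pd i b (fun y => metric i y a d) x
      - pd i d (fun y => metric i y a b) x)).

Definition jchristoffel (i : index X) (x : X) (a : 'I_m) : 'M[R]_m :=
  2^-1 *: (christoffel i x a
    - (pd i a (acs J i) x + acs J i x *m christoffel i x a) *m acs J i x).

Definition jcurvature (i : index X) (x : X) (a b : 'I_m) : 'M[R]_m :=
  pd i a (fun y => jchristoffel i y b) x - pd i b (fun y => jchristoffel i y a) x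
    + jchristoffel i x b *m jchristoffel i x a
    - jchristoffel i x a *m jchristoffel i x b.

Definition cmx (A : 'M[R]_m) : 'M[C]_m := map_mx (fun r => r%:C) A.

(* sqrt(-1)/(2 pi) times the curvature of [jchristoffel], on the complexified
   tangent bundle. *)
Definition chern_curvature (i : index X) (x : X) : fmatrix R m :=
  fun c d vs =>
    if vs is [:: v; w] then
      'i * ((2 * pi)^-1 *
        \sum_a \sum_b v 0 a * w 0 b * jcurvature i x a b c d)%:C
    else 0.

Definition proj10 (i : index X) (x : X) : 'M[C]_m :=
  (2%:R^-1 : C) *: (1%:M - ('i : C) *: cmx (acs J i x)).

(* The determinant on TM^(1,0) of (1 - exp(-Omega)) / Omega, where Omega is
   [chern_curvature]; forms of degree > 2n vanish. *)
Definition todd_inverse (i : index X) (x : X) : form R m :=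
  let Omega := chern_curvature i x in
  let P := proj10 i x in
  let E : fmatrix R m := fun a b vs =>
    \sum_(j < n.+1) ((-1) ^+ j / (j.+1`!)%:R)
      * iter j (fm_mul Omega) (fm_const 1%:M) a b vs in
  fm_det (fm_add (fm_mul (fm_const P) E) (fm_const (1%:M - P))).

(* Chern-Weil representative of Td(TM^(1,0)) = det (Omega / (1 - exp(-Omega))):
   the geometric series inverting [todd_inverse], which is 1 in degree 0. *)
Definition todd (i : index X) (x : X) : form R m := fun vs =>
  \sum_(l < n.+1) wpow (fun ws => form1 ws - todd_inverse i x ws) l vs.

(* The curvature of l^k is - sqrt(-1) k omega, so that its Chern character is
   represented by exp(k omega / (2 pi)). *)
Definition chern_character (k : nat) (i : index X) (x : X) : form R m := fun vs =>
  \sum_(q < n.+1)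
    ((q`!)%:R^-1 : C) * wpow (two_form ((k%:R / (2 * pi)) *: om omega i x)) q vs.

Definition riemann_roch (mu : {measure set borel -> \bar R}) (k : nat) : C :=
  integral_form mu (fun i x => wedge (chern_character k i x) (todd i x)).

(* A Hermitian vector bundle over X: the fiber at x is a space of functions on
   [label], and [sec] consists of the smooth sections. *)
Record hbundle := HBundle {
  label : Type;
  fiber : X -> set (label -> C);
  herm : X -> (label -> C) -> (label -> C) -> C;
  sec : set (X -> label -> C)
}.

Arguments fiber : clear implicits.
Arguments herm : clear implicits.
Arguments sec : clear implicits.

Definition l2 (mu : {measure set borel -> \bar R}) (L : hbundle)
    (s1 s2 : X -> label L -> C) : C :=
  cintegral mu (fun x => herm L x (s1 x) (s2 x)).

Arguments l2 mu L s1 s2 : clear implicits.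

Definition orthonormal (mu : {measure set borel -> \bar R}) (L : hbundle) (d : nat)
    (e : 'I_d -> X -> label L -> C) : Prop :=
  forall p q, l2 mu L (e p) (e q) = (p == q)%:R.

Arguments orthonormal mu L {d} e.

Definition span (L : hbundle) (d : nat) (e : 'I_d -> X -> label L -> C) :
    set (X -> label L -> C) :=
  [set s | exists c : 'I_d -> C, forall x t, s x t = \sum_p c p * e p x t].

Arguments span L {d} e.

Definition orthonormal_basis (mu : {measure set borel -> \bar R}) (L : hbundle)
    (d : nat) (H : set (X -> label L -> C)) (e : 'I_d -> X -> label L -> C) : Prop :=
  [/\ forall p, H (e p), orthonormal mu L e & H `<=` span L e].

Variable ell : prequantum_bundle omega.
Variable k : nat.

(* A point of the fiber of l^k at x is the family of its components in the
   trivializations around x, set to 0 for the charts away from x. *)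
Definition line_fiber (x : X) : set (index X -> C) :=
  [set u |
    (forall i j, dom X i x -> dom X j x -> u i = gl ell i j x ^+ k * u j) /\
    (forall i, ~ dom X i x -> u i = 0)].

Definition line_power : hbundle := {|
  label := index X;
  fiber := line_fiber;
  herm := fun x u v => (u (at_ X x))^*%C * v (at_ X x);
  sec := [set s |
    (forall x, line_fiber x (s x)) /\
    (forall i, csmooth_in i setT (fun x => s x i))]
|}.

Definition nabla (i : index X) (a : 'I_m) (f : X -> C) (x : X) : C :=
  cpd i a f x - 'i * (k%:R * conn ell i x 0 a)%:C * f x.

(* J comes from a complex structure: there are local complex coordinates z with
   dz o J = sqrt(-1) dz around every point. *)
Definition integrable_acs : Prop :=
  forall x : X, exists (V : set X) (z : 'I_n -> X -> C),
    let i := at_ X x in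
    [/\ open V, V x, V `<=` dom X i,
        forall p, csmooth_in i V (z p) &
        (forall y, V y ->
           let dz : 'M[C]_(m, n) := \matrix_(a, p) cpd i a (z p) y in
           cmx (acs J i y) *m dz = ('i : C) *: dz /\ \rank dz = n)].

Definition holomorphic (s : X -> index X -> C) : Prop :=
  forall i x (v : 'rV[C]_m), dom X i x ->
    v *m cmx (acs J i x) = - ('i : C) *: v ->
    \sum_a v 0 a * nabla i a (fun y => s y i) x = 0.

Definition kahler_space : set (X -> label line_power -> C) :=
  [set s | sec line_power s /\ holomorphic s].

(* The nonnegative Laplacian nabla^* nabla. *)
Definition laplacian (i : index X) (f : X -> C) (x : X) : C :=
  - \sum_a \sum_b (cometric i x a b)%:C *
      (nabla i a (nabla i b f) x
        - \sum_c (christoffel i x a b c)%:C * nabla i c f x).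

(* [s] is a (possibly zero) solution of Delta_k s = lam s, where
   Delta_k = laplacian - n k. *)
Definition eigensection (lam : R) (s : X -> label line_power -> C) : Prop :=
  sec line_power s /\
  forall i x, dom X i x ->
    laplacian i (fun y => s y i) x - (n * k)%N%:R * s x i = lam%:C * s x i.

(* [H] is the span of orthonormal eigensections [e] for the first [d]
   eigenvalues of Delta_k, which lie in (-a, a); the other eigenvalues lie to
   the right of n k + c. *)
Definition almost_kahler_space (mu : {measure set borel -> \bar R}) (a c : R)
    (d : nat) (H : set (X -> label line_power -> C)) : Prop :=
  exists (e : 'I_d -> X -> label line_power -> C) (lam : 'I_d -> R),
    [/\ (forall p, eigensection (lam p) (e p)) /\ orthonormal mu line_power e,
        forall p q : 'I_d, (p <= q)%N -> lam p <= lam q,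
        forall p, - a < lam p < a,
        (forall (nu : R) (s : X -> label line_power -> C),
           eigensection nu s -> (exists x t, s x t <> 0) ->
           (forall p, l2 mu line_power (e p) s = 0) ->
           (forall p, lam p <= nu) /\ (n * k)%N%:R + c < nu) &
        H = span line_power e].

(* The tensor product of l^k with the bundle of the forms of type (0,q), q >= 0:
   for every chart around x, such a form on T_xM, with the Hermitian structure
   induced by the metric. *)
Definition spinor_fiber (x : X) : set (index X * seq 'rV[R]_m -> C) :=
  [set u |
    [/\ forall i, dom X i x -> alternating (fun vs => u (i, vs)),
        (forall i v vs, dom X i x ->
           u (i, v *m acs J i x :: vs) = - 'i * u (i, v :: vs)),
        (forall i j vs, dom X i x -> dom X j x ->
           u (i, vs) = gl ell i j x ^+ k * u (j, [seq v *m jac i j x | v <- vs])) &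
        forall i vs, ~ dom X i x -> u (i, vs) = 0]].

Definition form_herm (i : index X) (x : X) (f g : form R m) : C :=
  \sum_(q < m.+1) ((q`!)%:R^-1 : C) *
    \sum_(a : {ffun 'I_q -> 'I_m}) \sum_(b : {ffun 'I_q -> 'I_m})
      (\prod_r cometric i x (a r) (b r))%:C
      * (f [seq basis_vec (a r) | r <- enum 'I_q])^*%C
      * g [seq basis_vec (b r) | r <- enum 'I_q].

Definition spinor_bundle : hbundle := {|
  label := (index X * seq 'rV[R]_m)%type;
  fiber := spinor_fiber;
  herm := fun x u v =>
    form_herm (at_ X x) x (fun vs => u (at_ X x, vs)) (fun vs => v (at_ X x, vs));
  sec := [set s |
    (forall x, spinor_fiber x (s x)) /\
    (forall i vs, csmooth_in i setT (fun x => s x (i, vs)))]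
|}.

(* The 1-form g(v^{1,0}, . ), where v^{1,0} = (v - sqrt(-1) J v) / 2. *)
Definition flat10 (i : index X) (x : X) (v : 'rV[R]_m) : form R m := fun ws =>
  if ws is [:: w] then
    (2%:R^-1 : C) *
      (bilin (metric i x) v w -i* bilin (metric i x) (v *m acs J i x) w)
  else 0.

(* Clifford multiplication, with c(v)^2 = - g(v, v); on forms of
   type (0,q), contracting with v^{0,1} is the same as contracting with v. *)
Definition clifford (i : index X) (x : X) (v : 'rV[R]_m) (f : form R m) : form R m :=
  fun vs => (Num.sqrt 2 : R)%:C * (wedge (flat10 i x v) f vs - f (v :: vs)).

(* The Clifford connection: the connection induced by [jchristoffel] and [nabla],
   plus the action of christoffel - jchristoffel, a skew endomorphism
   anticommuting with J, through the spin representation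
   B |-> 1/4 sum_r c(e_r) c(B e_r), for (e_r) an orthonormal frame. *)
Definition spin_nabla (i : index X) (b : 'I_m) (psi : X -> form R m) (x : X) :
    form R m := fun vs =>
  nabla i b (fun y => psi y vs) x
  - \sum_(j < size vs)
      psi x (set_nth 0 vs j (nth 0 vs j *m jchristoffel i x b))
  + (4%:R^-1 : C) * \sum_a \sum_c (cometric i x a c)%:C *
      clifford i x (basis_vec a)
        (clifford i x
          (basis_vec c *m (christoffel i x b - jchristoffel i x b)) (psi x)) vs.

Definition dirac (i : index X) (psi : X -> form R m) (x : X) : form R m :=
  fun vs => \sum_a \sum_b (cometric i x a b)%:C *
    clifford i x (basis_vec a) (spin_nabla i b psi x) vs.

(* The kernel of D_+ (for [odd_part = false]) or D_- (for [odd_part = true]). *)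
Definition dirac_kernel (odd_part : bool) : set (X -> label spinor_bundle -> C) :=
  [set s |
    [/\ sec spinor_bundle s,
        forall x i vs, odd (size vs) != odd_part -> s x (i, vs) = 0 &
        forall i x vs, dom X i x -> dirac i (fun y ws => s y (i, ws)) x vs = 0]].

Definition spinc_vanishing : Prop :=
  forall s : X -> label spinor_bundle -> C,
    dirac_kernel true s -> forall x t, s x t = 0.

End Geometry.

Arguments is_liouville {R n X} omega mu.
Arguments l2 {R n X} mu L s1 s2.
Arguments orthonormal {R n X} mu L {d} e.
Arguments span {R n X} L {d} e.
Arguments orthonormal_basis {R n X} mu L {d} H e.
Arguments kahler_space {R n X omega} J ell k.
Arguments eigensection {R n X omega} J ell k lam s.
Arguments almost_kahler_space {R n X omega} J ell k mu a c d H.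
Arguments dirac_kernel {R n X omega} J ell k odd_part.
Arguments fiber {R n X} L x : rename.
Arguments herm {R n X} L x u v : rename.
Arguments sec {R n X} L : rename.

Section CoherentStates.
Context {R : realType} {n : nat} {X : manifold R n.*2}.
Notation C := R[i].
Variables (L : hbundle (X := X)) (d : nat) (theta : 'I_d -> X -> label L -> C).

Definition epsilon (x : X) : C := \sum_j herm L x (theta j x) (theta j x).

(* An element sum_j (u_j)^bar (x) theta_j of (L_x)^bar (x) H is the
   family of the u_j. *)
Definition state (x : X) : set ('I_d -> label L -> C) :=
  [set u | forall j, fiber L x (u j)].

Definition state_norm2 (x : X) (u : 'I_d -> label L -> C) : C :=
  \sum_j herm L x (u j) (u j).

Definition state_value (x : X) (u : 'I_d -> label L -> C) : C :=
  \sum_j herm L x (u j) (theta j x).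

Definition coherent_state (x : X) : 'I_d -> label L -> C := fun j => theta j x.

Definition coherent_state_maximizes (x : X) : Prop :=
  let admissible := [set u | state x u /\ state_norm2 x u = epsilon x] in
  admissible (coherent_state x) /\
  forall u, admissible u ->
    `|state_value x u| ^+ 2 <= `|state_value x (coherent_state x)| ^+ 2.

End CoherentStates.

Arguments state {R n X} L {d} x.
Arguments state_norm2 {R n X} L {d} x u.
Arguments epsilon {R n X} L {d} theta x.
Arguments state_value {R n X} L {d} theta x u.
Arguments coherent_state {R n X} L {d} theta x.
Arguments coherent_state_maximizes {R n X} L {d} theta x.

(* Main.v *)
Require Import Defs.
From mathcomp Require Import all_boot all_order all_algebra all_fingroup.
From mathcomp Require Import complex.
From mathcomp Require Import all_classical all_reals all_analysis.
From mathcomp Require Import sesquilinear spectral ring.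

(** The value at [x] of a state [s] = sum_j (u_j)^bar (x) theta_j is
    sum_j h(u_j, theta_j(x)), which is the inner product of [s] with the
    coherent state in the tensor product of the conjugate of L_x with H.
    By Cauchy-Schwarz its modulus squared is at most ||s||^2 ||Phi_x||^2, hence
    at most eps(x)^2 when ||s||^2 = eps(x), and Phi_x attains this bound because
    its value is exactly ||Phi_x||^2 = eps(x).  This argument is
    [psd_coherent_state_maximizes]; it is the same in the three quantizations.

    What remains is that the fiberwise pairing is a positive semidefinite
    Hermitian form.  A fiber sits inside a space of all functions on labels, on
    which the pairing is degenerate, so Cauchy-Schwarz is proved in the
    semidefinite case ([psd_Cauchy_Schwarz]).  For the line bundle the pairing
    is a product of the value at one label with a conjugate.  For spinors it is
    a sum over degrees q of the q-th tensor power of the inverse metric,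
    evaluated on the coefficients of two forms.  Writing the inverse metric as a
    Gram matrix S^* S by the spectral theorem ([real_psd_Gram]) turns each
    tensor power into a sum of terms l(f)^* l(g) with [l] linear, and these are
    positive ([form_herm_psd]).  The inverse metric itself is symmetric and
    positive because omega is J-invariant and tamed by J. *)

Import Order.TTheory GRing.Theory Num.Theory.
Import numFieldNormedType.Exports.

Local Open Scope classical_set_scope.
Local Open Scope ring_scope.

(** * Positive semidefinite Hermitian forms *)

Section PositiveForms.
Context {C : numClosedFieldType}.

Definition psd_hermitian {V : lmodType C} (B : V -> V -> C) : Prop :=
  [/\ forall u, scalar (B u), forall u v, B v u = (B u v)^*
    & forall u, 0 <= B u u].

Lemma psd_square {V : lmodType C} (l : V -> C) :
  scalar l -> psd_hermitian (fun u v => (l u)^* * l v).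
Proof.
move=> lin_l; split=> [u a v w | u v | u].
- by rewrite lin_l mulrDr mulrCA.
- by rewrite rmorphM /= conjCK mulrC.
- by rewrite mulrC mul_conjC_ge0.
Qed.

Lemma psd_comp {V W : lmodType C} (l : V -> W) (B : W -> W -> C) :
  linear l -> psd_hermitian B -> psd_hermitian (fun u v => B (l u) (l v)).
Proof.
by move=> lin_l [linB symB posB]; split=> [u a v w||]; rewrite ?lin_l ?linB.
Qed.

Lemma psd_sum {V : lmodType C} {I : finType} (c : I -> C) (B : I -> V -> V -> C) :
  (forall i, 0 <= c i) -> (forall i, psd_hermitian (B i)) ->
  psd_hermitian (fun u v => \sum_i c i * B i u v).
Proof.
move=> c_ge0 psdB; split=> [u a v w | u v | u].
- rewrite mulr_sumr -big_split; apply: eq_bigr => i _ /=.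
  by have [linB _ _] := psdB i; rewrite linB mulrDr mulrCA.
- rewrite rmorph_sum; apply: eq_bigr => i _ /=.
  by have [_ symB _] := psdB i; rewrite rmorphM /= (geC0_conj (c_ge0 i)) -symB.
- by apply: sumr_ge0 => i _; have [_ _ posB] := psdB i; rewrite mulr_ge0.
Qed.

(** Positivity of B on z x - B(x,x) y, with z = B(x,y), gives the inequality
    multiplied by B(x,x); this settles the case B(x,x) <> 0, and B(y,y) <> 0
    by symmetry.  When both vanish, x - z^* y shows -2|z|^2 >= 0. *)
Lemma psd_Cauchy_Schwarz {V : lmodType C} {B : V -> V -> C} (u v : V) :
  psd_hermitian B -> `|B u v| ^+ 2 <= B u u * B v v.
Proof.
move=> [linB symB posB].
have B0 w : B w 0 = 0.
  by have := linB w (-1) w w; rewrite scaleN1r addNr mulN1r addNr.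
have linZ w a x : B w (a *: x) = a * B w x.
  by rewrite -[a *: x]addr0 linB B0 addr0.
have combine (x y : V) a b c : 0 <= c -> a^* * b * B x y = - c ->
    c *+ 2 <= `|a| ^+ 2 * B x x + `|b| ^+ 2 * B y y.
  move=> c_ge0 ab; rewrite -subr_ge0; have := posB (a *: x + b *: y).
  have linl w : B (a *: x + b *: y) w = a^* * B x w + b^* * B y w.
    by rewrite symB linB linZ rmorphD !rmorphM /= -!symB.
  have ba : a * b^* * (B x y)^* = - c.
    have := congr1 (@Num.conj C) ab.
    by rewrite 2!rmorphM rmorphN /= conjCK (geC0_conj c_ge0).
  rewrite linl !linB !linZ (symB x y) !normCK; congr (0 <= _).
  transitivity (a * a^* * B x x + b * b^* * B y y
    + (a^* * b * B x y + a * b^* * (B x y)^* )); first by ring.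
  by rewrite ab ba; ring.
have nondeg (x y : V) : B x x != 0 -> `|B x y| ^+ 2 <= B x x * B y y.
  move=> Bx_neq0; have Bx_gt0 : 0 < B x x by rewrite lt_def Bx_neq0 posB.
  have c_ge0 : 0 <= B x x * `|B x y| ^+ 2 by rewrite mulr_ge0 ?posB ?exprn_ge0.
  have /(combine x y (B x y) (- B x x) _ c_ge0) : (B x y)^* * - B x x * B x y
      = - (B x x * `|B x y| ^+ 2) by rewrite normCK; ring.
  rewrite normrN (ger0_norm (posB x)) mulr2n [_ * B x x]mulrC lerD2l.
  by rewrite expr2 -mulrA ler_pM2l.
have [Bu0 | /nondeg //] := eqVneq (B u u) 0.
have [Bv0 | /nondeg Bvu] := eqVneq (B v v) 0; last first.
  by rewrite mulrC -norm_conjC -symB.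
have c_ge0 : 0 <= `|B u v| ^+ 2 by rewrite exprn_ge0.
have /(combine u v 1 (- (B u v)^* ) _ c_ge0) : 1^* * - (B u v)^* * B u v
    = - `|B u v| ^+ 2 by rewrite conjC1 normCK; ring.
by rewrite Bu0 Bv0 !mulr0 addr0 pmulrn_lle0.
Qed.
End PositiveForms.

(** * Gram factorization *)

Section Gram.
Local Open Scope sesquilinear_scope.

(** By the spectral theorem A = P^* D P with P unitary; the eigenvalues are
    nonnegative, so S = D^(1/2) P.  A complex factor is enough, since the
    forms to be paired have complex coefficients. *)
Lemma real_psd_Gram {R : realType} {m} {A : 'M[R]_m} :
  A^T = A -> (forall v : 'rV_m, 0 <= (v *m A *m v^T) 0 0) ->
  exists S : 'M[R[i]]_m,
    forall a b, (A a b)%:C%C = \sum_s (S s a)^* * S s b.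
Proof.
move=> symA posA; set A' : 'M[R[i]]_m := map_mx (real_complex R) A.
have hermA' : A' \is hermsymmx.
  apply/is_hermitianmxP; rewrite expr0 scale1r.
  by apply/matrixP=> a b; rewrite !mxE -[in LHS]symA mxE; apply/esym/conjc_real.
have := hermitian_normalmx hermA' => /orthomx_spectralP.
set P := spectralmx A'; set D := spectral_diag A' => A'E.
have uP : P \is unitarymx := spectral_unitarymx A'.
have posA' (z : 'rV[R[i]]_m) : 0 <= (z *m A' *m z ^t* ) 0 0.
  pose x := map_mx (@complex.Re R) z; pose y := map_mx (@complex.Im R) z.
  (* For z = x + iy, the cross terms cancel by symmetry of A, which leaves
     x A x^T + y A y^T. *)
  suff -> : (z *m A' *m z ^t* ) 0 0
      = ((x *m A *m x^T) 0 0 + (y *m A *m y^T) 0 0)%:C%C.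
    by rewrite lecR addr_ge0.
  pose c (w : 'rV[R]_m) := map_mx (real_complex R) w.
  have zE : z = c x + 'i%C *: c y.
    by apply/rowP=> a; rewrite !mxE [LHS]complexE.
  have zCE : z ^t* = (c x)^T - 'i%C *: (c y)^T.
    apply/colP=> a; rewrite !mxE; case: (z 0 a) => p q.
    apply/eqP; rewrite eq_complex /=.
    by rewrite ?(mul0r, mul1r, mulr0, subr0, addr0, oppr0, add0r, sub0r) !eqxx.
  have cross : c y *m A' *m (c x)^T = c x *m A' *m (c y)^T.
    transitivity (c y *m A' *m (c x)^T)^T.
      by apply/matrixP=> p q; rewrite [RHS]mxE !ord1.
    by rewrite !trmx_mul trmxK mulmxA map_trmx symA.
  have real w : (c w *m A' *m (c w)^T) 0 0 = ((w *m A *m w^T) 0 0)%:C%C.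
    by rewrite /c /A' map_trmx -!map_mxM mxE.
  rewrite zCE zE !(mulmxDl, mulmxBr, mulmxDr) -!scalemxAr -!scalemxAl cross.
  rewrite scalerA -expr2 sqr_i scaleN1r opprB addrACA subrr addr0.
  by rewrite mxE !real -rmorphD.
have D_ge0 s : 0 <= D 0 s.
  have := posA' (row s P).
  have -> : (row s P *m A' *m (row s P) ^t* ) 0 0 = (P *m A' *m P ^t* ) s s.
    by rewrite -row_mul !mxE; apply: eq_bigr => j _; rewrite !mxE.
  rewrite A'E invmx_unitary// !mulmxA (unitarymxP uP) mul1mx.
  by rewrite -mulmxA (unitarymxP uP) mulmx1 !mxE eqxx mulr1n.
exists (\matrix_(s, a) (sqrtC (D 0 s) * P s a)) => a b.
have -> : (A a b)%:C%C = A' a b by rewrite mxE.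
rewrite A'E invmx_unitary// !mxE; apply: eq_bigr => s _.
rewrite !mxE (bigD1 s)//= big1 => [|t ts]; rewrite !mxE ?eqxx ?(negPf ts) ?mulr0//.
rewrite mulr1n addr0 rmorphM /= (geC0_conj (x := sqrtC _)) ?sqrtC_ge0//.
by rewrite mulrACA -expr2 sqrtCK mulrCA mulrA.
Qed.

End Gram.

(** * The Hermitian structures on the fibers *)

Section Metric.
Context {R : realType} {n : nat} {X : manifold R n.*2} {omega : symplectic_form X}.
Variable J : compatible_acs omega.

Lemma bilinE {m} (W : 'M[R]_m) (a b : 'I_m) :
  bilin W (basis_vec a) (basis_vec b) = W a b.
Proof.
rewrite /bilin /basis_vec mxE (bigD1 b)//= big1 => [|c cb].
  by rewrite -rowE !mxE !eqxx mulr1 addr0.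
by rewrite !mxE eqxx (negPf cb) mulr0.
Qed.

(** Let W be the matrix of omega.  Since J^2 = -1, invariance J W J^T = W gives
    - J W = W J^T, and the left side is the transpose of the right one because W
    is skew. *)
Lemma metric_sym {i x} : Defs.dom X i x -> (metric J i x)^T = metric J i x.
Proof.
move=> xi; rewrite /metric trmx_mul trmxK om_alt// mulmxN.
set W := om omega i x; set A := acs J i x.
have inv : A *m W *m A^T = W.
  apply/matrixP=> a b; rewrite -[RHS]bilinE -(acs_invariant J _ _ xi).
  rewrite -[LHS]bilinE /bilin !trmx_mul !mulmxA; congr (_ _ _).
have := congr1 (mulmx A) inv.
by rewrite !mulmxA acs_square// mulNmx mul1mx mulNmx => <-; rewrite opprK.
Qed.

Lemma metric_gt0 {i x} {v : 'rV[R]_(n.*2)} : Defs.dom X i x -> v != 0 ->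
  0 < (v *m metric J i x *m v^T) 0 0.
Proof.
move=> xi v0; have := acs_tame J xi v0.
by rewrite /bilin trmx_mul !mulmxA.
Qed.

Lemma metric_unit {i x} : Defs.dom X i x -> metric J i x \in unitmx.
Proof.
move=> xi; rewrite -row_free_unit -kermx_eq0; apply/rowV0P => v /sub_kermxP vg0.
apply/eqP; apply: contraT => /(metric_gt0 xi).
by rewrite vg0 mul0mx mxE ltxx.
Qed.

Lemma cometric_sym {i x} : Defs.dom X i x -> (cometric J i x)^T = cometric J i x.
Proof. by move=> xi; rewrite /cometric trmx_inv metric_sym. Qed.

(** With w = v g^-1, the value of g^-1 on v is the value of g on w. *)
Lemma cometric_ge0 {i x} (v : 'rV[R]_(n.*2)) : Defs.dom X i x ->
  0 <= (v *m cometric J i x *m v^T) 0 0.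
Proof.
move=> xi; set w := v *m cometric J i x.
have vE : v = w *m metric J i x by rewrite mulmxKV ?metric_unit.
have -> : w *m v^T = w *m metric J i x *m w^T.
  by rewrite vE trmx_mul metric_sym// mulmxA.
by have [-> | /(metric_gt0 xi)/ltW //] := eqVneq w 0; rewrite !mul0mx mxE.
Qed.

(** If g^-1 = S^* S then the q-th tensor power of g^-1 is the Gram matrix of the
    q-th tensor power of S, whose rows, indexed by [s], are the functionals
    [l q s]. *)
Lemma form_herm_psd {i x} : Defs.dom X i x -> psd_hermitian (form_herm J i x).
Proof.
move=> xi.
have [S gramS] := real_psd_Gram (cometric_sym xi)
  (fun v => cometric_ge0 v xi).
pose ev q (a : {ffun 'I_q -> 'I_(n.*2)}) : seq 'rV[R]_(n.*2) :=
  [seq basis_vec (a r) | r <- enum 'I_q].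
pose l q (s : {ffun 'I_q -> 'I_(n.*2)}) (f : Defs.form R n.*2) : R[i] :=
  \sum_(a : {ffun 'I_q -> 'I_(n.*2)}) (\prod_r S (s r) (a r)) * f (ev q a).
have lin_l q s : scalar (l q s).
  move=> a f g; rewrite /l mulr_sumr -big_split; apply: eq_bigr => c _ /=.
  by rewrite mulrDr mulrCA.
have gram q f g : \sum_s (l q s f)^* * l q s g =
    \sum_(a : {ffun 'I_q -> 'I_(n.*2)}) \sum_(b : {ffun 'I_q -> 'I_(n.*2)})
      (\prod_r cometric J i x (a r) (b r))%:C%C * (f (ev q a))^* * g (ev q b).
  transitivity (\sum_(s : {ffun 'I_q -> 'I_(n.*2)})
      \sum_(a : {ffun 'I_q -> 'I_(n.*2)})
      \sum_(b : {ffun 'I_q -> 'I_(n.*2)})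
      (\prod_r ((S (s r) (a r))^* * S (s r) (b r)))
        * ((f (ev q a))^* * g (ev q b))).
    apply: eq_bigr => s _; rewrite /l rmorph_sum mulr_suml; apply: eq_bigr => a _.
    rewrite mulr_sumr; apply: eq_bigr => b _.
    by rewrite rmorphM rmorph_prod mulrACA -big_split.
  rewrite exchange_big; apply: eq_bigr => a _.
  rewrite exchange_big; apply: eq_bigr => b _.
  rewrite -mulr_suml -mulrA rmorph_prod; congr (_ * _).
  (* The sum over s of a product over r factors into a product of sums, which
     are the entries of the Gram matrix. *)
  rewrite -(bigA_distr_bigA (fun r s => (S s (a r))^* * S s (b r))) /=.
  by apply: eq_bigr => r _; rewrite gramS.
have -> : form_herm J i x = fun f g => \sum_(q < (n.*2).+1) (q`!)%:R^-1
    * \sum_s 1 * ((l q s f)^* * l q s g).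
  apply/funext=> f; apply/funext=> g; apply: eq_bigr => q _; congr (_ * _).
  under [RHS]eq_bigr do rewrite mul1r.
  by rewrite gram.
apply: psd_sum => [q|q]; first by rewrite invr_ge0 ler0n.
by apply: psd_sum => [s|s]; [exact: ler01 | exact/psd_square/lin_l].
Qed.

Lemma line_herm_psd (ell : prequantum_bundle omega) k (x : X) :
  psd_hermitian (herm (line_power ell k) x).
Proof.
have lin : scalar (fun u : Defs.index X -> R[i] => u (at_ X x)) by [].
exact: psd_square lin.
Qed.

Lemma spinor_herm_psd (ell : prequantum_bundle omega) k (x : X) :
  psd_hermitian (herm (spinor_bundle J ell k) x).
Proof.
have lin : linear (fun (u : Defs.index X * seq 'rV[R]_(n.*2) -> R[i])
    (vs : seq 'rV[R]_(n.*2)) => u (at_ X x, vs)) by [].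
exact: (psd_comp _ _ lin (form_herm_psd (dom_at x))).
Qed.

End Metric.

(** * Coherent states *)

Lemma psd_coherent_state_maximizes {R : realType} {n : nat} {X : manifold R n.*2}
    (L : hbundle (X := X)) d (theta : 'I_d -> X -> label L -> R[i]) (x : X) :
  psd_hermitian (herm L x) -> (forall j, fiber L x (theta j x)) ->
  coherent_state_maximizes L theta x.
Proof.
move=> psdL in_fiber; split=> [|u [_ norm_u]]; first by split.
pose B (v w : 'I_d -> label L -> R[i]) := \sum_j 1 * herm L x (v j) (w j).
have psdB : psd_hermitian B.
  apply: psd_sum => [j|j]; first exact: ler01.
  exact: (psd_comp (fun v : 'I_d -> label L -> R[i] => v j)).
have BE v w : \sum_j herm L x (v j) (w j) = B v w.
  by apply: eq_bigr => j _; rewrite mul1r.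
have [_ _ posB] := psdB.
rewrite /state_value !BE; apply: le_trans (psd_Cauchy_Schwarz _ _ psdB) _.
by rewrite -!BE [X in X * _]norm_u /epsilon BE ger0_norm ?posB// expr2.
Qed.

(** In the almost Kaehler case the quantum space is a span of eigensections, so
    that its elements take values in the fibers because fibers are linear. *)
Lemma line_fiber_span {R : realType} {n : nat} {X : manifold R n.*2}
    {omega : symplectic_form X} (ell : prequantum_bundle omega) k d (x : X)
    (e : 'I_d -> X -> Defs.index X -> R[i]) s :
  (forall p, line_fiber ell k x (e p x)) ->
  Defs.span (line_power ell k) e s -> line_fiber ell k x (s x).
Proof.
move=> fib_e [c sE]; split=> [i j xi xj | i xi]; rewrite !sE.
  rewrite mulr_sumr; apply: eq_bigr => p _.
  by have [glue _] := fib_e p; rewrite (glue i j)// mulrCA.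
by apply: big1 => p _; have [_ ->] := fib_e p; rewrite ?mulr0.
Qed.

Theorem theorem5p1 (R : realType) (n : nat) (X : manifold R n.*2)
    (omega : symplectic_form X) (ell : prequantum_bundle omega)
    (J : compatible_acs omega)
    (mu : {measure set (g_sigma_algebraType (@open X)) -> \bar R})
    (mu_liouville : is_liouville omega mu)
    (k d : nat) (k_gt0 : (0 < k)%N) (d_RR : riemann_roch J mu k = d%:R) :
  [/\ integrable_acs J ->
        forall theta : 'I_d -> X -> label (line_power ell k) -> R[i],
          orthonormal_basis mu (line_power ell k) (kahler_space J ell k) theta ->
          forall x : X, coherent_state_maximizes (line_power ell k) theta x,
      forall (a c : R) (H : set (X -> label (line_power ell k) -> R[i])),
        0 < a -> almost_kahler_space J ell k mu a c d H ->
        forall theta : 'I_d -> X -> label (line_power ell k) -> R[i],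
          orthonormal_basis mu (line_power ell k) H theta ->
          forall x : X, coherent_state_maximizes (line_power ell k) theta x
    & spinc_vanishing J ell k ->
        forall theta : 'I_d -> X -> label (spinor_bundle J ell k) -> R[i],
          orthonormal_basis mu (spinor_bundle J ell k)
            (dirac_kernel J ell k false) theta ->
          forall x : X, coherent_state_maximizes (spinor_bundle J ell k) theta x].
Proof.
split=> [_ theta [theta_H _ _] x | a c H _ AK theta [theta_H _ _] x
  | _ theta [theta_H _ _] x]; apply: psd_coherent_state_maximizes.
- exact: line_herm_psd.
- by move=> j; have [[fib _] _] := theta_H j; apply: fib.
- exact: line_herm_psd.
- move=> j; have [e [lam [[eig _] _ _ _ HE]]] := AK.
  apply: (line_fiber_span ell k d x e (theta j)) => [p|]; last by rewrite -HE.
  by have [[fib _] _] := eig p; apply: fib.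
- exact: spinor_herm_psd.
- by move=> j; have [[fib _] _ _] := theta_H j; apply: fib.
Qed.
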